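(* Every minimal Cantor system $(C,T)$ can be realized as a minimal subsystem of a differentiable system $([0,1],f)$ such that $f'|_C\equiv 0$. That is, for every minimal Cantor system $(C,T)$ there exist a differentiable map $f\colon[0,1]\to[0,1]$ and an embedding $h\colon C\to[0,1]$ such that $f\circ h=h\circ T$ (so $h(C)$ is an $f$-invariant set on which $f$ is conjugate to $T$) and $f'(x)=0$ for every $x\in h(C)$.
   Context: A Cantor set is a (nonempty) $0$-dimensional compact metric space without isolated points. A Cantor system is a pair $(C,T)$ where $C$ is a Cantor set and $T\colon C\to C$ is a continuous map (invertible or noninvertible). A system is minimal if all of its (forward) orbits $\{T^n(x): n\ge 0\}$ are dense. An embedding is a homeomorphism onto its image. Differentiability on $[0,1]$ means that $f$ has a derivative at each point of $[0,1]$ (one-sided at the endpoints); the derivative need not be continuous. *)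

(* Defs.v *)
From HB Require Import structures.
From mathcomp Require Import all_boot all_order all_algebra.
From mathcomp Require Import all_classical all_reals all_analysis.

Set Implicit Arguments.
Unset Strict Implicit.
Unset Printing Implicit Defensive.

Import Order.TTheory GRing.Theory Num.Theory.
Import numFieldNormedType.Exports.

Local Open Scope classical_set_scope.
Local Open Scope ring_scope.

(* [cantor_like] admits the empty space, hence the extra conjunct. Its
   [zero_dimensional] asks that distinct points be separated by a clopen set;
   for compact Hausdorff spaces this amounts to having a base of clopen sets
   (see [zero_dimensional_cvg]). *)
Definition cantor_set (R : realType) (C : metricType R) : Prop :=
  [set: C] !=set0 /\ cantor_like C.

Definition cantor_system (R : realType) (C : metricType R) (T : C -> C) : Prop :=
  cantor_set C /\ continuous T.

Definition minimal_system (X : topologicalType) (T : X -> X) : Prop :=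
  forall x : X, dense (range (fun n : nat => iter n T x)).

(* Homeomorphism onto the image; [g] is the inverse homeomorphism, and its
   values off [range h] are irrelevant. The domain is meant to be nonempty. *)
Definition embedding (X Y : topologicalType) (h : X -> Y) : Prop :=
  continuous h /\
  exists2 g : Y -> X, cancel h g & {within range h, continuous g}.

(* The derivative of the restriction of [f] to [A]: the difference quotient is
   taken over the points of [A] only, so that on a closed interval it is the
   ordinary derivative inside and the one-sided derivative at the endpoints. *)
Definition has_derivative_on (R : realType) (A : set R) (f : R -> R) (x l : R)
    : Prop :=
  (f y - f x) / (y - x) @[y --> within A x^'] --> l.

Definition differentiable_on (R : realType) (A : set R) (f : R -> R) : Prop :=
  forall x : R, A x -> exists l : R, has_derivative_on A f x l.

(* Main.v *)
Require Import Defs.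
From HB Require Import structures.
From mathcomp Require Import all_boot all_order all_algebra.
From mathcomp Require Import all_classical all_reals all_analysis.
From mathcomp Require Import lra ring.

Set Implicit Arguments.
Unset Strict Implicit.
Unset Printing Implicit Defensive.

Import Order.TTheory GRing.Theory Num.Theory.
Import numFieldNormedType.Exports.

Local Open Scope classical_set_scope.
Local Open Scope ring_scope.

(** The embedding [h] must shrink every orbit step: [`|h (T y) - h (T x)|] has
    to be [o(`|h y - h x|)] as [y] tends to [x], separately at each [x].

    Fix disjoint nonempty clopen sets [D_n]. By minimality every point enters
    [D_n]; let [e_n x] be the time this takes. Off [D_n] one step of [T] lowers
    [e_n] by exactly one, and a given point lies in at most one [D_n]. So if the
    cells of the [n]-th partition of [C] get sizes that increase steeply with
    [e_n], then [T] maps each cell outside [D_n] to a much smaller one, and the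
    exceptional step through [D_n] affects a given point for at most one [n].
    Entry times require no invertibility of [T].

    For [T] to map cells into cells, the code [c_n x] records the itinerary of
    [x] up to its entry into [D_n], read in the partition of level [n - 1]
    refined by one more coordinate of [C = {0, 1}^nat]
    ([tower_codes_exist]). The embedding is the series
    [h x = \sum_n c_(n+1) x * w_n x], where [w_n x = 1 / p!] and the integer
    [p] is a level-dependent constant minus [e_n x] ([code_weights_exist]). The
    constants grow so fast that two points first separated at level [n + 1] are
    at distance at least [w_n x / 2], whereas their images still share the
    code [c_n] and hence, once [n] is large, are at distance at most
    [w_n x / (2 (n + 1))] ([embedding_of_weights]).

    It remains to extend the resulting map of [h(C)] to the interval. Any map
    with zero derivative on a closed set extends with zero derivative there if
    one interpolates over each gap by the cubic [3 t ^ 2 - 2 t ^ 3]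
    ([flat_extension]). *)

(** * Locally constant codes on a Cantor system *)

Definition locally_constant (X : topologicalType) (Y : Type) (f : X -> Y)
    : Prop :=
  forall x, \forall y \near x, f y = f x.

(** A Cantor-like space is homeomorphic to [{0, 1}^nat]; only the coordinates of
    the homeomorphism are kept, because everything later is phrased with
    locally constant functions. *)
Lemma cantor_coordinates (R : realType) (C : metricType R) (x0 : C) :
  cantor_like C ->
  exists b : C -> nat -> bool,
    [/\ forall n, locally_constant (b^~ n),
        forall x y, b x =1 b y -> x = y &
        forall s : nat -> bool, exists x, b x =1 s].
Proof.
move=> CC.
pose C' : pseudoPMetricType R :=
  HB.pack_for (pseudoPMetricType R) (C : Type) (PseudoMetric.on C)
    (isPointed.Build (C : Type) x0).
have [f [fc fcl]] := @homeomorphism_cantor_like R C' CC.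
have fI : injective f by move=> u v; apply: (@inj _ _ _ f); rewrite inE.
have /choice [g fg] : forall y : C', exists s, f s = y.
  by move=> y; have [s _ <-] := @surj _ _ _ _ f y I; exists s.
exists (fun x n => g x n); split.
- move=> n x.
  (* [g] is the inverse of a closed map, so it is continuous: the points whose
     [n]-th coordinate differs from that of [x] form a closed set. *)
  pose A := [set s : cantor_space | s n != g x n].
  have cA : closed A.
    apply: (@preimage_closed cantor_space bool (fun s => s n)
              [set i | i != g x n]); last exact: discrete_closed.
    by move=> s _; exact: (@proj_continuous nat (fun=> bool) n s).
  have : nbhs (x : C') (~` (f @` A)).
    apply: open_nbhs_nbhs; split; first exact/closed_openC/fcl.
    move=> [s sA]; rewrite -[in RHS](fg x) => /fI sg.
    by move: sA; rewrite /A /= sg eqxx.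
  apply: filterS => y /= fAy; apply: contrapT => /eqP gyx.
  by apply: fAy; exists (g y).
- by move=> x y gxy; rewrite -(fg x) -(fg y); congr (f _); exact/funext.
- by move=> s; exists (f s) => n; congr (_ n); apply: fI; rewrite fg.
Qed.

Lemma continuous_iter (X : topologicalType) (T : X -> X) (n : nat) :
  continuous T -> continuous (iter n T).
Proof.
move=> cT; elim: n => [|n IHn] x; first exact: cvg_id.
exact: (continuous_comp (IHn x) (cT _)).
Qed.

Lemma locally_constant_iter (X : topologicalType) (Y : Type) (T : X -> X)
    (q : X -> Y) :
  continuous T -> locally_constant q ->
  forall n x, \forall y \near x, forall i, (i < n)%N ->
    q (iter i T y) = q (iter i T x).
Proof.
move=> cT lq n x.
have : \forall y \near x, forall i : 'I_n, q (iter i T y) = q (iter i T x).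
  apply: (@filter_forall _ _ (fun i y => _) (nbhs x)) => i.
  exact: (continuous_iter (n := i) cT (lq (iter i T x))).
by apply: filterS => y qy i lt_in; exact: (qy (Ordinal lt_in)).
Qed.

(** The entry time is the first [k >= 0] with [T^k x] in [d], so it vanishes
    exactly on [d]; using this rather than the return time makes every point
    outside [d] lose exactly one unit, for noninvertible [T] too. It is locally
    constant since it depends on finitely many membership tests. *)
Lemma entry_time (X : topologicalType) (T : X -> X) (d : pred X) :
  continuous T -> locally_constant d ->
  (forall x, exists k, d (iter k T x)) ->
  exists e : X -> nat,
    [/\ locally_constant e,
        forall x, d x = (e x == 0) &
        forall x, ~~ d x -> e x = (e (T x)).+1].
Proof.
move=> cT ld hit; pose e x := ex_minn (hit x); exists e; split.
- move=> x; near=> y.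
  have dy : forall i, (i < (e x).+1)%N -> d (iter i T y) = d (iter i T x).
    by near: y; exact: locally_constant_iter.
  rewrite /e in dy *; move: dy.
  case: ex_minnP => n dn nmin dy; case: ex_minnP => m dm mmin.
  have le_mn : (m <= n)%N by apply: mmin; rewrite dy.
  by apply/eqP; rewrite eqn_leq le_mn nmin // -dy.
- move=> x; rewrite /e; case: ex_minnP => -[|n] dn nmin //.
  by apply: contraTF (isT) => dx; have := nmin 0 dx.
- move=> x dx; rewrite /e; case: ex_minnP => -[|n]; first by rewrite (negPf dx).
  move=> dn nmin; case: ex_minnP => m dm mmin; congr (_.+1).
  apply/eqP; rewrite eqn_leq -ltnS nmin ?mmin //; last by rewrite iterSr.
  by rewrite -iterSr.
Unshelve. all: by end_near. Qed.

(** One level of a Kakutani-Rokhlin tower. The code of [x] is its [q]-itinerary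
    up to and including the entry into [d]. Applying [T] deletes the first
    letter of that word, which is why equal codes off [d] have images with
    equal codes; and the length of the word gives back the entry time. *)
Lemma itinerary_code (X : topologicalType) (T : X -> X) (d : pred X)
    (q : X -> nat) :
  continuous T -> locally_constant d ->
  (forall x, exists k, d (iter k T x)) ->
  locally_constant q ->
  exists ec : (X -> nat) * (X -> nat),
    [/\ locally_constant ec.1, locally_constant ec.2,
        forall x, ~~ d x -> ec.1 x = (ec.1 (T x)).+1,
        forall x y, ec.2 x = ec.2 y -> ec.1 x = ec.1 y /\ q x = q y &
        forall x y, ec.2 x = ec.2 y -> ~~ d x -> ec.2 (T x) = ec.2 (T y)].
Proof.
move=> cT ld hit lq; have [e [le e0 eS]] := entry_time cT ld hit.
pose it x := [seq q (iter i T x) | i <- iota 0 (e x).+1].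
have size_it x : size (it x) = (e x).+1 by rewrite size_map size_iota.
have itI x y : pickle (it x) = pickle (it y) -> it x = it y.
  exact: (pcan_inj pickleK).
have eI x y : it x = it y -> e x = e y.
  by move=> xy; apply: succn_inj; rewrite -!size_it xy.
have itS x : ~~ d x -> it (T x) = behead (it x).
  move=> dx; rewrite /it (eS _ dx).
  have -> : iota 0 (e (T x)).+2 = 0%N :: map S (iota 0 (e (T x)).+1).
    by rewrite -(iotaDl 1 0).
  rewrite map_cons /behead -map_comp; apply: eq_map => i.
  by rewrite [RHS]/= -iterS iterSr.
exists (e, pickle \o it); split => //=.
- move=> x; near=> y.
  have ey : e y = e x by near: y; exact: le.
  rewrite /= /it ey; congr pickle; apply/eq_in_map => i.
  rewrite mem_iota add0n /=; move: i.
  by near: y; exact: locally_constant_iter.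
- by move=> x y /itI xy; split; [exact: eI | case: xy].
- move=> x y /itI xy dx; have dy : ~~ d y by rewrite e0 -(eI _ _ xy) -e0.
  by rewrite !itS // xy.
Unshelve. all: by end_near. Qed.

(** [c n x] names the cell of [x] in the [n]-th of a sequence of finer and finer
    partitions, and [e n x] is the number of steps before [x] meets the [n]-th
    exceptional set. On that set [code_step] fails at level [n], so its
    threshold [N] has to depend on [x]. *)
Record tower_codes (X : topologicalType) (T : X -> X)
    (c e : nat -> X -> nat) : Prop := TowerCodes {
  code_locally_constant : forall n, locally_constant (c n);
  time_locally_constant : forall n, locally_constant (e n);
  code0 : forall x y, c 0 x = c 0 y;
  code_refine : forall n x y, c n.+1 x = c n.+1 y -> c n x = c n y;
  code_separates : forall x y, (forall n, c n x = c n y) -> x = y;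
  code_time : forall n x y, c n x = c n y -> e n x = e n y;
  code_step : forall x, exists N, forall n, (N <= n)%N ->
    e n x = (e n (T x)).+1 /\ forall y, c n x = c n y -> c n (T x) = c n (T y)
}.

Lemma tower_codes_exist (R : realType) (C : metricType R) (T : C -> C) :
  cantor_system T -> minimal_system T ->
  exists c e, tower_codes T c e.
Proof.
move=> [[[x0 _] CC] cT] minT.
have [b [lb bI bS]] := cantor_coordinates x0 CC.
(* [d n] is the set of points whose coordinates start with [n] zeros followed
   by a one. *)
pose d n x := b x n && [forall i : 'I_n, ~~ b x i].
have ld n : locally_constant (d n).
  move=> x; near=> y; rewrite /d.
  have -> : b y n = b x n by near: y; exact: lb.
  congr (_ && _); apply: eq_forallb => i; congr (~~ _); move: i.
  near: y; apply: (@filter_forall _ _ (fun i y => _) (nbhs x)) => i.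
  exact: lb.
have hit n x : exists k, d n (iter k T x).
  have [z bz] := bS (fun i => i == n).
  have dz : d n z.
    rewrite /d bz eqxx; apply/forallP => i.
    by rewrite bz neq_ltn ltn_ord.
  have [||w [dw [k _ kw]]] := minT x [set y | d n y].
  - by exists z.
  - rewrite openE => y /= dy; rewrite /interior /=; apply: filterS (ld n y).
    by move=> w /= ->.
  - by exists k; rewrite kw.
have dF m n x : (m < n)%N -> d m x -> ~~ d n x.
  move=> lt_mn /andP[bm _]; apply/negP => /andP[_ /forallP bn].
  by have := bn (Ordinal lt_mn); rewrite /= bm.
have N_ex : forall x, exists m, forall n, (m <= n)%N -> ~~ d n x.
  move=> x; have [[m dm]|/forallNP nd] := pselect (exists m, d m x).
    by exists m.+1 => n lt_mn; exact: dF dm.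
  by exists 0%N => n _; apply/negP/nd.
have [N dN] := choice N_ex.
have G_ex : forall nq : nat * (C -> nat),
    exists ec : (C -> nat) * (C -> nat),
    locally_constant nq.2 ->
    [/\ locally_constant ec.1, locally_constant ec.2,
        forall x, ~~ d nq.1 x -> ec.1 x = (ec.1 (T x)).+1,
        forall x y, ec.2 x = ec.2 y -> ec.1 x = ec.1 y /\ nq.2 x = nq.2 y &
        forall x y, ec.2 x = ec.2 y -> ~~ d nq.1 x ->
          ec.2 (T x) = ec.2 (T y)].
  move=> [n q] /=; have [lq|nlq] := pselect (locally_constant q).
    by have [ec ecP] := itinerary_code cT (ld n) (hit n) lq; exists ec.
  by exists (q, q) => /nlq.
have [G GP] := choice G_ex.
pose q n (c : C -> nat) x := pickle (c x, b x n).
(* The trivial code at level 0 makes any two distinct points agree at some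
   level before they are separated. *)
pose ec := fix ec n := if n is m.+1 then G (m, q m (ec m).2)
                       else (fun=> 0%N, fun=> 0%N).
have lq n (c : C -> nat) : locally_constant c -> locally_constant (q n c).
  move=> lc x; near=> y; rewrite /q; congr (pickle (_, _)).
    by near: y; exact: lc.
  by near: y; exact: lb.
have qI n (c : C -> nat) x y : q n c x = q n c y -> c x = c y /\ b x n = b y n.
  by move=> /(pcan_inj pickleK)[].
have lec n : locally_constant (ec n).1 /\ locally_constant (ec n).2.
  elim: n => [|n [_ IHn]]; first by split=> x; apply: nearW.
  by have [] := GP (n, q n (ec n).2) (lq n _ IHn).
have GPn n := GP (n, q n (ec n).2) (lq n _ (lec n).2).
exists (fun n => (ec n).2), (fun n => (ec n).1); split => //.
- by move=> n; exact: (lec n).2.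
- by move=> n; exact: (lec n).1.
- by move=> n x y; have [_ _ _ h _] := GPn n; move=> /h [_ /qI[]].
- move=> x y cxy; apply: bI => n; have [_ _ _ h _] := GPn n.
  by have [_ /qI[]] := h _ _ (cxy n.+1).
- by case=> [//|n] x y; have [_ _ _ h _] := GPn n; move=> /h[].
- move=> x; exists (N x).+1 => -[//|n] Nn; have [_ _ eS _ cS] := GPn n.
  by split=> [|y cxy]; [apply: eS | apply: cS]; rewrite ?dN.
Unshelve. all: by end_near. Qed.

(** * Embedding the coded system into the line *)

Lemma locally_constant_bounded (X : topologicalType) (f : X -> nat) :
  compact [set: X] -> locally_constant f -> exists M, forall x, (f x <= M)%N.
Proof.
move=> /compact_near_coveringP cX lf.
have [|M _ fM] := cX nat \oo (fun n x => (f x <= n)%N) _.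
  move=> x _; exists ([set y | f y = f x], [set n | (f x <= n)%N]).
    by split; [exact: lf | exists (f x)].
  by move=> [y n] /= [->].
by exists M => x; exact: (fM M (leqnn M) x I).
Qed.

(** Inverse factorials serve as a scale whose ratios between consecutive terms
    eventually fall below any [1 / k], so that raising the argument by one is
    all that a step of [T] has to do. *)
Lemma inv_fact_decay (R : realFieldType) (k a b : nat) :
  (a < b)%N -> (k <= b)%N -> k%:R * b`!%:R^-1 <= a`!%:R^-1 :> R.
Proof.
case: b => // b; rewrite ltnS => le_ab le_kb.
have le_fact : (a`! <= b`!)%N.
  by apply: dvdn_leq; rewrite ?fact_gt0 // (fact_split le_ab) dvdn_mulr.
rewrite ler_pdivrMr ?ltr0n ?fact_gt0 // ler_pdivlMl ?ltr0n ?fact_gt0 //.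
by rewrite -natrM ler_nat factS mulnC leq_mul.
Qed.

(** [w n x] is the width of one digit of level [n + 1] inside the cell of [x] at
    level [n], and [M n] exceeds all digits of level [n] by at least one; thus
    [M n.+1 * w n x] bounds the width of that cell. [weight_decay] keeps the
    deeper digits within a quarter of [w n x], and [weight_step] makes [T]
    shrink cells. *)
Record code_weights (R : realType) (X : topologicalType) (T : X -> X)
    (c : nat -> X -> nat) (M : nat -> R) (w : nat -> X -> R) : Prop :=
  CodeWeights {
  weight_digit : forall n x, (c n x)%:R + 1 <= M n;
  weight_gt0 : forall n x, 0 < w n x;
  weight_code : forall n x y, c n x = c n y -> w n x = w n y;
  weight_decay : forall n x, 4 * (M n.+2 * w n.+1 x) <= w n x;
  weight_small : forall n x, M n.+1 * w n x <= n.+1%:R^-1;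
  weight_step : forall x, exists N, forall n, (N <= n)%N ->
    2 * (M n.+1 * w n (T x)) <= n.+1%:R^-1 * w n x
}.

(** The weight [1 / p!] with [p = t n + (E n - e n x)] works for two reasons.
    First, [T] lowers [e n x] by one and so raises [p] by one. Second, [t]
    grows so fast that all the values of [p] at level [n] lie below those at
    level [n + 1], and none is smaller than the factor [k n] to be gained. *)
Lemma code_weights_exist (R : realType) (X : topologicalType) (T : X -> X)
    (c e : nat -> X -> nat) :
  compact [set: X] -> tower_codes T c e ->
  exists (M : nat -> R) w, code_weights T c M w.
Proof.
move=> cX tc.
have [M cM] := choice (fun n =>
  locally_constant_bounded cX (code_locally_constant tc n)).
have [E eE] := choice (fun n =>
  locally_constant_bounded cX (time_locally_constant tc n)).
pose k n := (4 * (n.+1 * (M n.+1).+1))%N.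
pose t := fix t n := (k n + if n is m.+1 then t m + E m else 0)%N.
have tk n : (k n <= t n)%N by case: n => [|n] /=; rewrite ?addn0 // leq_addr.
have tS n : (t n + E n < t n.+1)%N.
  by rewrite /= -[ltnLHS]add0n ltn_add2r muln_gt0.
pose p n x := (t n + (E n - e n x))%N.
have kp n x : (k n <= p n x)%N by rewrite (leq_trans (tk n)) ?leq_addr.
have pS n x : (p n x < p n.+1 x)%N.
  apply: leq_trans (leq_addr _ _); apply: leq_ltn_trans (tS n).
  by rewrite leq_add2l leq_subr.
pose w n x : R := (p n x)`!%:R^-1.
have w0 n x : 0 < w n x by rewrite invr_gt0 ltr0n fact_gt0.
have kE n (y v : R) : (k n)%:R * y <= v ->
    4 * ((M n.+1).+1%:R * y) <= n.+1%:R^-1 * v.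
  move=> kyv; rewrite ler_pdivlMl ?ltr0n //; apply: le_trans kyv.
  by rewrite /k !natrM le_eqVlt; apply/orP; left; apply/eqP; ring.
have decay n q x : (q < p n x)%N ->
    4 * ((M n.+1).+1%:R * w n x) <= n.+1%:R^-1 * q`!%:R^-1.
  by move=> qp; apply/kE/inv_fact_decay.
have inv1 n : n.+1%:R^-1 <= 1 :> R by rewrite invf_le1 ?ler1n ?ltr0n.
exists (fun n => (M n).+1%:R), w; split => //.
- by move=> n x; rewrite -natr1 lerD2r ler_nat.
- by move=> n x y cxy; rewrite /w /p (code_time tc cxy).
- move=> n x; apply: (le_trans (decay n.+1 _ x (pS n x))).
  by rewrite ler_piMl // ltW ?w0.
- (* Compare with [1 = 1 / 0!]. *)
  move=> n x; have := decay n 0%N x _; rewrite fact0 invr1 mulr1.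
  have : (0 < p n x)%N by apply: leq_trans (kp n x); rewrite !muln_gt0.
  move=> /[swap] /[apply]; apply: le_trans.
  by rewrite ler_peMl ?ler1n // mulr_ge0 // ltW ?w0.
- move=> x; have [N stepN] := code_step tc x; exists N => n /stepN[eS _].
  have pT : (p n x < p n (T x))%N.
    by rewrite /p eS -addnS leq_add2l subnSK // -eS.
  have := decay n _ _ pT; apply: le_trans.
  by rewrite ler_wpM2r ?mulr_ge0 ?ler_nat // ltW ?w0.
Qed.

(** [h x] is the sum of the digits [c n.+1 x] with weights [w n x], defined as
    the supremum of the partial sums [S n x]. The intervals from [S n.+1 x] to
    [U n x = S n.+1 x + w n x / 4] are nested, so [h x] lies in all of them;
    both estimates [h_near] and [h_far] are read off from these intervals. *)
Lemma embedding_of_weights (R : realType) (X : topologicalType) (T : X -> X)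
    (c e : nat -> X -> nat) (M : nat -> R) (w : nat -> X -> R) :
  tower_codes T c e -> code_weights T c M w ->
  exists h : X -> R,
    [/\ forall x, 0 <= h x <= 1, continuous h, injective h &
      forall x eps, 0 < eps -> exists2 delta, 0 < delta & forall y,
        `|h y - h x| < delta ->
        `|h (T y) - h (T x)| <= eps * `|h y - h x|].
Proof.
move=> tc wc.
have w0 n x := weight_gt0 wc n x.
pose S n x := \sum_(i < n) (c i.+1 x)%:R * w i x.
have SS n x : S n.+1 x = S n x + (c n.+1 x)%:R * w n x.
  by rewrite /S big_ord_recr.
have S_homo m n x : (m <= n)%N -> S m x <= S n x.
  elim: n => [|n IHn]; first by rewrite leqn0 => /eqP ->.
  rewrite leq_eqVlt => /predU1P[-> //|/IHn mn]; apply: (le_trans mn).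
  by rewrite SS lerDl mulr_ge0 // ltW.
pose U n x := S n.+1 x + w n x / 4.
have U_homo m n x : (m <= n)%N -> U n x <= U m x.
  elim: n => [|n IHn]; first by rewrite leqn0 => /eqP ->.
  rewrite leq_eqVlt => /predU1P[-> //|/IHn mn]; apply: le_trans mn.
  rewrite /U SS; have := weight_decay wc n x.
  have := weight_digit wc n.+2 x; have := w0 n.+1 x.
  by nra.
have SU m n x : S m x <= U n x.
  pose l := maxn m n; apply: (le_trans (S_homo m l.+1 x _)).
    by rewrite leqW // leq_maxl.
  apply: (@le_trans _ _ (U l x)); last by apply: U_homo; rewrite leq_maxr.
  by rewrite lerDl divr_ge0 // ltW.
pose h x := sup (range (S^~ x)).
have h_has_sup x : has_sup (range (S^~ x)).
  by split; [exists (S 0 x), 0%N | exists (U 0 x) => _ [m _ <-]].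
have Sh n x : S n x <= h x.
  by apply: ub_le_sup; [have [] := h_has_sup x | exists n].
have hU n x : h x <= S n.+1 x + w n x / 4.
  by apply: ge_sup; [have [] := h_has_sup x | move=> _ [m _ <-]; exact: SU].
have code_le m n x y : (m <= n)%N -> c n x = c n y -> c m x = c m y.
  elim: n => [|n IHn]; first by rewrite leqn0 => /eqP ->.
  by rewrite leq_eqVlt => /predU1P[-> //|/IHn mn /(code_refine tc)].
have S_code n x y : c n x = c n y -> S n x = S n y.
  move=> cxy; apply: eq_bigr => i _.
  rewrite (code_le i.+1 _ _ _ _ cxy) //.
  by rewrite (weight_code wc (code_le i _ _ _ _ cxy)) // ltnW.
have h_near n x y : c n x = c n y -> `|h y - h x| <= M n.+1 * w n x.
  move=> cxy; have := Sh n x; have := Sh n y; have := hU n x; have := hU n y.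
  rewrite !SS -(weight_code wc cxy) -(S_code _ _ _ cxy).
  have := weight_digit wc n.+1 x; have := weight_digit wc n.+1 y.
  by move=> ? ? ? ? ? ?; have := w0 n x; rewrite ler_norml; nra.
have h_far n x y : c n x = c n y -> c n.+1 x <> c n.+1 y ->
    w n x <= 2 * `|h y - h x|.
  move=> cxy; have := Sh n.+1 x; have := Sh n.+1 y.
  have := hU n x; have := hU n y.
  rewrite !SS -(weight_code wc cxy) -(S_code _ _ _ cxy) => hy hx Sy Sx.
  have wx := w0 n x.
  move/eqP; rewrite neq_ltn => /orP[]; rewrite -(ler_nat R) -natr1 => cc.
    by have := ler_norm (h y - h x); nra.
  by have := ler_norm (h x - h y); rewrite distrC; nra.
have split_level x y : x <> y ->
    exists n, c n x = c n y /\ c n.+1 x <> c n.+1 y.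
  move=> xy; have /existsNP[m /eqP cm] : ~ forall n, c n x = c n y.
    by move=> /(code_separates tc).
  have ex_m : exists m, c m x != c m y by exists m.
  case: (ex_minnP ex_m) => -[|n]; first by rewrite (code0 tc x y) eqxx.
  move=> /eqP cn nmin; exists n; split=> //; apply: contrapT => /eqP /nmin.
  by rewrite ltnn.
have w_homo m n x : (m <= n)%N -> w n x <= w m x.
  elim: n => [|n IHn]; first by rewrite leqn0 => /eqP ->.
  rewrite leq_eqVlt => /predU1P[-> //|/IHn mn]; apply: le_trans mn.
  have := weight_decay wc n x; have := weight_digit wc n.+2 x.
  have : 0 <= (c n.+2 x)%:R :> R by exact: ler0n. have := w0 n.+1 x.
  by nra.
have inv_small eps : 0 < eps -> exists n, n.+1%:R^-1 < eps :> R.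
  move=> e0; have [n _ /(_ n (leqnn n))] := near_infty_natSinv_lt (PosNum e0).
  by exists n.
exists h; split.
- move=> x; have := Sh 0 x; have := hU 0 x; rewrite SS /S big_ord0.
  have := weight_small wc 0 x; have := weight_digit wc 1 x; have := w0 0 x.
  by rewrite invr1; nra.
- move=> x; apply/cvgrPdist_le => eps e0; have [n ne] := inv_small _ e0.
  apply: filterS (code_locally_constant tc n x) => y cxy.
  rewrite distrC (le_trans (h_near n x y _)) //.
  by rewrite (le_trans (weight_small wc n x)) // ltW.
- move=> x y hxy; apply: contrapT => /split_level[n [cn cn1]].
  by have := h_far n x y cn cn1; rewrite hxy subrr normr0 mulr0 leNgt w0.
- move=> x eps e0; have [n0 n0e] := inv_small _ e0.
  have [N1 stepw] := weight_step wc x; have [N2 stepc] := code_step tc x.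
  (* Points within [w K x / 2] of [h x] are separated from [x] only after
     level [K], by [h_far]. *)
  pose K := maxn n0 (maxn N1 N2); exists (w K x / 2); first by rewrite divr_gt0.
  move=> y; have [-> _|/eqP xy] := eqVneq x y.
    by rewrite !subrr normr0 mulr0.
  have [n [cn cn1]] := split_level _ _ xy; have far := h_far _ _ _ cn cn1.
  move=> near_x; have leKn : (K <= n)%N.
    rewrite leqNgt; apply/negP => /ltnW /(w_homo _ _ x) wKn.
    move: near_x far wKn.
    by lra.
  move: leKn; rewrite /K !geq_max => /and3P[n0n N1n N2n].
  have /(h_near n _ _) := (stepc n N2n).2 y cn.
  have ne : n.+1%:R^-1 <= eps.
    by apply: le_trans (ltW n0e); rewrite lef_pV2 ?posrE ?ltr0n // ler_nat ltnS.
  have := stepw n N1n; have := w0 n x; move: far ne.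
  set u := n.+1%:R^-1; set v := `|h y - h x|.
  have : 0 <= v by exact: normr_ge0.
  by nra.
Qed.

(** An injective continuous map on a compact space is an embedding: outside a
    neighbourhood of [x], compactness keeps [h] uniformly away from [h x]. *)
Lemma compact_injective_embedding (X : topologicalType) (R : realType)
    (h : X -> R) :
  [set: X] !=set0 -> compact [set: X] -> continuous h -> injective h ->
  embedding h.
Proof.
move=> [x0 _] /compact_near_coveringP cX ch hI; split=> //.
have g_ex y : exists x, range h y -> h x = y.
  by have [[x _ <-]|nr] := pselect (range h y); [exists x | exists x0].
have [g gP] := choice g_ex.
have hK : cancel h g by move=> x; apply/hI/gP; exists x.
exists g => //; apply/subspace_continuousP => _ [x _ <-] U gU.
have nU : nbhs x U by rewrite -[x]hK.
have : \forall d \near 0^'+, [set: X] `<=` (fun z => `|h z - h x| < d -> U z).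
  apply: cX => z _; have [->|zx] := eqVneq z x.
    exists (U, setT) => /=; first by split => //; exact: filterT.
    by move=> [y d] /= [].
  (* By the triangle inequality no [y] near [z] has [h y] within [r / 2] of
     [h x]. *)
  pose r := `|h z - h x|.
  have r0 : 0 < r by rewrite normr_gt0 subr_eq0; apply: contra_neq zx => /hI.
  have r20 : 0 < r / 2 by rewrite divr_gt0.
  exists ([set y | `|h z - h y| < r / 2], [set d | d < r / 2]) => /=.
    split; last exact: nbhs_right_lt.
    by have /cvgrPdist_lt := ch z; apply.
  move=> [y d] /= [zy dr] yx; exfalso.
  have := ler_distD (h y) (h z) (h x); rewrite -/r; move: zy dr yx; lra.
move=> hU; near (0 : R)^'+ => d.
have hUd : [set: X] `<=` (fun z => `|h z - h x| < d -> U z) by near: d.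
have d0 : 0 < d by near: d; exact: nbhs_right_gt.
exists d => //= _ /= /[swap] -[z _ <-] zx; rewrite /from_subspace hK.
by apply: hUd => //; rewrite distrC.
Unshelve. all: by end_near. Qed.

(** * Extending maps with zero derivative across gaps *)

(** The cubic that joins 0 at 0 to 1 at 1 with zero slope at both ends. *)
Definition smoothstep (R : realType) (t : R) : R := 3 * t ^+ 2 - 2 * t ^+ 3.

Lemma smoothstep_flip (R : realType) (t : R) :
  smoothstep (1 - t) = 1 - smoothstep t.
Proof. by rewrite /smoothstep; ring. Qed.

Lemma smoothstep_bounds (R : realType) (t : R) : 0 <= t <= 1 ->
  [/\ 0 <= smoothstep t, smoothstep t <= 1 & smoothstep t <= 3 * t ^+ 2].
Proof.
move=> /andP[t0 t1]; rewrite /smoothstep; split.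
- have -> : 3 * t ^+ 2 - 2 * t ^+ 3 = t ^+ 2 * (3 - 2 * t) by ring.
  by rewrite mulr_ge0 ?sqr_ge0 //; lra.
- rewrite -subr_ge0.
  have -> : 1 - (3 * t ^+ 2 - 2 * t ^+ 3) = (1 - t) ^+ 2 * (1 + 2 * t) by ring.
  by rewrite mulr_ge0 ?sqr_ge0 //; lra.
- by rewrite gerBl mulr_ge0 ?exprn_ge0.
Qed.

(** The estimate at a point [x] of the closed set, seen from a point [y] in a
    gap: [A] is the distance from [x] to the nearer end [a] of the gap, [D] the
    distance from [a] to [y], and [L] the length of the gap, so that
    [`|y - x| = A + D]. The hypothesis controls the increment to the far end
    [b] only relative to [A + L], which may be much larger than [A + D]. If
    [L <= A] the two are comparable; if [A < L] the interpolation has slope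
    [O(eps)]; and if [b] is too far from [x] for the hypothesis to apply, the
    zero slope of the cubic at [a] gives the bound. Distances instead of points
    make the statement cover gaps on both sides of [x]. *)
Lemma smoothstep_gap_bound (R : realType) (eps delta A D L Fx Fa Fb : R) :
  0 < eps -> 0 < delta -> 0 <= A -> 0 <= D <= L -> 0 < L ->
  `|Fa - Fx| <= eps * A -> `|Fb - Fa| <= 1 ->
  (A + L < delta -> `|Fb - Fx| <= eps * (A + L)) ->
  A + D < delta / 2 -> A + D < eps * delta ^+ 2 / 12 ->
  `|Fa + (Fb - Fa) * smoothstep (D / L) - Fx| <= 10 * eps * (A + D).
Proof.
move=> e0 d0 A0 /andP[D0 DL] L0 FaFx FbFa FbFx AD1 AD2.
pose s := D / L.
have sL : s * L = D by rewrite /s divfK // gt_eqF.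
have s01 : 0 <= s <= 1.
  by rewrite /s divr_ge0 ?(ltW L0) //= ler_pdivrMr // mul1r.
have [p0 p1 p2] := smoothstep_bounds s01; rewrite -/s.
move: p0 p1 p2; set p := smoothstep s => p0 p1 p2.
have s0 : 0 <= s by case/andP: s01.
have -> : Fa + (Fb - Fa) * p - Fx = (Fa - Fx) + (Fb - Fa) * p by ring.
apply: (le_trans (ler_normD _ _)); rewrite normrM (ger0_norm p0).
suff : `|Fb - Fa| * p <= 9 * eps * (A + D) by move: FaFx; nra.
have [/FbFx {}FbFx|Ldelta] := ltP (A + L) delta.
  have FF : `|Fb - Fa| <= eps * (2 * A + L).
    have := ler_distD Fx Fb Fa; rewrite (distrC Fx) => ?; lra.
  have [LA|AL] := leP L A.
    apply: (@le_trans _ _ `|Fb - Fa|); first by rewrite ler_piMr.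
    apply: (le_trans FF); nra.
  apply: (@le_trans _ _ (eps * (3 * L) * (3 * s))); last by nra.
  apply: ler_pM => //; first by nra.
  apply: (le_trans p2); rewrite ler_pM2l // expr2 ler_piMr //.
  by case/andP: s01.
have L2 : delta / 2 <= L by lra.
apply: (@le_trans _ _ p); first by rewrite ler_piMl.
apply: (@le_trans _ _ (eps * D)); last by nra.
apply: (le_trans p2).
have : delta ^+ 2 * (3 * s ^+ 2) <= 12 * D ^+ 2.
  have -> : 12 * D ^+ 2 = (2 * L) ^+ 2 * (3 * s ^+ 2) by rewrite -sL; ring.
  apply: ler_wpM2r; first by rewrite mulr_ge0 ?sqr_ge0.
  by rewrite ler_sqr ?nnegrE; lra.
move=> h; have d20 : 0 < delta ^+ 2 by rewrite exprn_gt0.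
rewrite -(ler_pM2l d20); apply: (le_trans h).
rewrite expr2; nra.
Qed.

Lemma closed_nearest_below (R : realType) (K : set R) (y : R) :
  closed K -> (exists2 a, K a & a <= y) ->
  exists a, [/\ K a, a <= y & forall z, K z -> z <= y -> z <= a].
Proof.
move=> cK [a Ka ay]; pose B := K `&` [set z | z <= y].
have B0 : B !=set0 by exists a.
have ubB : has_ubound B by exists y => z [].
have [Ks sy] : B (sup B).
  have : closed B by apply: closedI => //; exact: closed_le.
  by apply; exact: closure_sup.
by exists (sup B); split => // z Kz zy; apply: ub_le_sup.
Qed.

Lemma closed_nearest_above (R : realType) (K : set R) (y : R) :
  closed K -> (exists2 b, K b & y <= b) ->
  exists b, [/\ K b, y <= b & forall z, K z -> y <= z -> b <= z].
Proof.
move=> cK [b Kb yb].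
have cNK : closed [set z | K (- z)].
  apply: (@preimage_closed R R -%R K) => // z _; exact: oppr_continuous.
have [|a [Ka ay amax]] := @closed_nearest_below R _ (- y) cNK.
  by exists (- b); rewrite /= ?opprK // lerN2.
exists (- a); split => //; first by rewrite lerNr.
by move=> z Kz yz; rewrite lerNl; apply: amax; rewrite /= ?opprK // lerN2.
Qed.

(** [a y] and [b y] are the ends of the gap around [y]; both equal [y] when [y]
    belongs to [K]. *)
Lemma closed_gaps (R : realType) (K : set R) :
  closed K -> (forall y, exists2 a, K a & a <= y) ->
  (forall y, exists2 b, K b & y <= b) ->
  exists a b : R -> R, forall y,
    [/\ K (a y), K (b y), a y <= y <= b y &
      forall z, K z -> (z <= y -> z <= a y) /\ (y <= z -> b y <= z)].
Proof.
move=> cK Klo Khi.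
have [a aP] := choice (fun y => closed_nearest_below cK (Klo y)).
have [b bP] := choice (fun y => closed_nearest_above cK (Khi y)).
exists a, b => y; have [Ka ay amax] := aP y; have [Kb yb bmin] := bP y.
by split; rewrite ?ay // => z Kz; split; [exact: amax | exact: bmin].
Qed.

(** Zero derivative at [x] relative to [K], written without quotients so that it
    can be fed to estimates. *)
Definition flat_at (R : realType) (K : set R) (F : R -> R) (x : R) : Prop :=
  forall eps, 0 < eps -> exists2 delta, 0 < delta &
    forall y, K y -> `|y - x| < delta -> `|F y - F x| <= eps * `|y - x|.

Lemma flat_at_derivative (R : realType) (K : set R) (f : R -> R) (x : R) :
  flat_at K f x -> has_derivative_on K f x 0.
Proof.
move=> fx; apply/cvgrPdist_le => eps e0; have [d d0 dP] := fx _ e0.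
rewrite near_withinE; apply: cvg_within.
exists d => //= y yd Ky; rewrite sub0r normrN normrM normfV.
have [->|yx] := eqVneq y x; first by rewrite subrr normr0 mul0r ltW.
rewrite ler_pdivrMr ?normr_gt0 ?subr_eq0 //; apply: dP => //.
by rewrite distrC.
Qed.

Lemma has_derivative_on_subset (R : realType) (A B : set R) (f : R -> R)
    (x l : R) :
  A `<=` B -> has_derivative_on B f x l -> has_derivative_on A f x l.
Proof.
move=> AB fx U /fx; apply: (@filterS _ x^') => y BU Ay; exact: BU (AB _ Ay).
Qed.

Lemma smoothstep_quotient (R : realType) (s t : R) :
  smoothstep s - smoothstep t =
    (s - t) * (3 * (s + t) - 2 * (s * s + s * t + t * t)).
Proof. by rewrite /smoothstep; ring. Qed.

Lemma smoothstep_interpolation_derivative (R : realType) (a b u v y : R) :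
  a < b ->
  exists l, has_derivative_on setT
    (fun z => u + (v - u) * smoothstep ((z - a) / (b - a))) y l.
Proof.
move=> ab; pose s z : R := (z - a) / (b - a); pose k := (v - u) / (b - a).
pose Q z := k * (3 * (s z + s y) - 2 * (s z * s z + s z * s y + s y * s y)).
have ba : b - a != 0 by rewrite subr_eq0 gt_eqF.
exists (Q y); apply: cvg_trans (_ : Q z @[z --> y] --> Q y).
  move=> U QU; apply: (@filterS _ (nbhs y)) QU => z QU zy _ /=.
  move: QU; congr U; rewrite /Q.
  have -> : u + (v - u) * smoothstep (s z) - (u + (v - u) * smoothstep (s y)) =
    (v - u) * (smoothstep (s z) - smoothstep (s y)) by ring.
  rewrite smoothstep_quotient /k /s; field.
  by rewrite ba subr_eq0 zy.
have sc : s z @[z --> y] --> s y.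
  by apply: cvgMl; apply: cvgB; [exact: cvg_id | exact: cvg_cst].
apply: cvgM; first exact: cvg_cst.
apply: cvgB; apply: cvgM; try exact: cvg_cst.
  by apply: cvgD => //; exact: cvg_cst.
apply: cvgD; last exact: cvg_cst.
by apply: cvgD; apply: cvgM => //; exact: cvg_cst.
Qed.

(** A special case of Jarnik's extension theorem. The set [K] is unbounded on
    both sides so that every point outside it lies in a bounded gap. *)
Lemma flat_extension (R : realType) (K : set R) (F : R -> R) :
  closed K -> (forall y, exists2 a, K a & a <= y) ->
  (forall y, exists2 b, K b & y <= b) ->
  (forall x, K x -> 0 <= F x <= 1) -> (forall x, K x -> flat_at K F x) ->
  exists f : R -> R,
    [/\ forall x, K x -> f x = F x, forall x, 0 <= f x <= 1,
        forall x, exists l, has_derivative_on setT f x l &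
        forall x, K x -> has_derivative_on setT f x 0].
Proof.
move=> cK Klo Khi F01 flatF.
have [a [b abP]] := closed_gaps cK Klo Khi.
(* On [K] the two ends coincide, so the second term vanishes there and [f]
   agrees with [F] whatever the value of the quotient by zero. *)
pose f y :=
  F (a y) + (F (b y) - F (a y)) * smoothstep ((y - a y) / (b y - a y)).
have fK x : K x -> f x = F x.
  move=> Kx; rewrite /f; have [_ _ /andP[ax xb] /(_ _ Kx)[xa bx]] := abP x.
  have -> : a x = x by apply: le_anti; rewrite ax xa.
  have -> : b x = x by apply: le_anti; rewrite xb bx.
  by rewrite subrr mul0r addr0.
have gap y : ~ K y -> a y < y < b y.
  move=> nKy; have [Ka Kb /andP[ay yb] _] := abP y.
  rewrite !lt_neqAle ay yb !andbT; apply/andP; split.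
    by apply/eqP => ya; apply: nKy; rewrite -ya.
  by apply/eqP => ya; apply: nKy; rewrite ya.
have flatf x : K x -> flat_at setT f x.
  move=> Kx eps e0; have e10 : 0 < eps / 10 by rewrite divr_gt0.
  have [d d0 dP] := flatF _ Kx _ e10.
  pose d' := Num.min (d / 2) (eps / 10 * d ^+ 2 / 12).
  have d'0 : 0 < d' by rewrite lt_min !(divr_gt0, mulr_gt0, exprn_gt0).
  exists d' => // y _; rewrite lt_min => /andP[yd1 yd2].
  rewrite (fK _ Kx); have [Ky|nKy] := pselect (K y).
    rewrite fK //; apply: (@le_trans _ _ (eps / 10 * `|y - x|)).
      by apply: dP => //; lra.
    by rewrite ler_wpM2r // ler_piMr ?(ltW e0) // invf_le1 ?ler1n.
  have /andP[ay yb] := gap _ nKy.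
  have [Ka Kb _ /(_ _ Kx)[xa bx]] := abP y.
  have Fab : `|F (b y) - F (a y)| <= 1.
    by have := F01 _ Ka; have := F01 _ Kb; rewrite ler_norml; lra.
  have -> : eps = 10 * (eps / 10) by field.
  have [xy|yx] := leP x y.
    have {}xa := xa xy; rewrite ger0_norm ?subr_ge0 // in yd1 yd2 *.
    have yxE : y - x = (a y - x) + (y - a y) by ring.
    have axn : `|a y - x| = a y - x by rewrite ger0_norm // subr_ge0.
    have bxE : `|b y - x| = (a y - x) + (b y - a y).
      by rewrite ger0_norm; [ring | lra].
    rewrite yxE; apply: (smoothstep_gap_bound e10 d0);
      rewrite -?yxE //; try lra.
    - by rewrite -axn; apply: dP => //; rewrite axn; lra.
    - by rewrite -bxE; exact: dP.
  have {}bx := bx (ltW yx); rewrite distrC gtr0_norm ?subr_gt0 // in yd1 yd2 *.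
  have xyE : x - y = (x - b y) + (b y - y) by ring.
  have bxn : `|b y - x| = x - b y by rewrite distrC ger0_norm // subr_ge0.
  have axE : `|a y - x| = (x - b y) + (b y - a y).
    by rewrite distrC ger0_norm; [ring | lra].
  (* The gap lies to the left of [x]: its near end is [b y], so the
     interpolation is read backwards. *)
  have -> : f y = F (b y) +
      (F (a y) - F (b y)) * smoothstep ((b y - y) / (b y - a y)).
    have -> : (b y - y) / (b y - a y) = 1 - (y - a y) / (b y - a y).
      by field; lra.
    by rewrite smoothstep_flip /f; ring.
  rewrite xyE; apply: (smoothstep_gap_bound e10 d0); rewrite -?xyE //; try lra.
  - by rewrite -bxn; apply: dP => //; rewrite bxn; lra.
  - by rewrite distrC.
  - by rewrite -axE; exact: dP.
exists f; split => //.
- move=> x; have [Ka Kb /andP[ax xb] _] := abP x.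
  have t01 : 0 <= (x - a x) / (b x - a x) <= 1.
    have [->|ab] := eqVneq (b x) (a x).
      by rewrite subrr invr0 mulr0 lexx ler01.
    have ab0 : 0 < b x - a x.
      by rewrite subr_gt0 lt_neqAle eq_sym ab (le_trans ax).
    apply/andP; split; first by rewrite divr_ge0 ?(ltW ab0) // subr_ge0.
    by rewrite ler_pdivrMr // mul1r lerB.
  have [s0 s1 _] := smoothstep_bounds t01.
  by have := F01 _ Ka; have := F01 _ Kb; rewrite /f; nra.
- move=> x; have [Kx|nKx] := pselect (K x).
    by exists 0; apply/flat_at_derivative/flatf.
  have /andP[ax xb] := gap _ nKx.
  have [l lP] := smoothstep_interpolation_derivative (F (a x)) (F (b x)) x
    (lt_trans ax xb).
  exists l; move: lP; apply: cvg_trans => U fU.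
  have fE z : a x < z < b x -> f z =
      F (a x) + (F (b x) - F (a x)) * smoothstep ((z - a x) / (b x - a x)).
    move=> /andP[az zb]; have [Kax Kbx _ inx] := abP x.
    have [Kaz Kbz /andP[az' zb'] inz] := abP z.
    have -> : a x = a z.
      apply: le_anti; rewrite (inz _ Kax).1 ?(ltW az) //=.
      have [//|xaz] := leP (a z) x; first exact: (inx _ Kaz).1.
      have := (inx _ Kaz).2 (ltW xaz); lra.
    have -> // : b x = b z.
    apply: le_anti; rewrite (inz _ Kbx).2 ?(ltW zb) // andbT.
    have [xbz|bzx] := leP x (b z); first exact: (inx _ Kbz).2.
    have := (inx _ Kbz).1 (ltW bzx); lra.
  have near_ab : \forall z \near x, a x < z < b x.
    by near=> z; apply/andP; split; near: z; [exact: lt_nbhsr|exact: lt_nbhsl].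
  have : x^' (fun z => a x < z < b x) by apply: (@filterS _ (nbhs x)) near_ab.
  move: fU; apply: (@filterS2 _ x^') => z Uz zab _; rewrite /= !fE ?ax //.
  exact: Uz.
- by move=> x /flatf/flat_at_derivative.
Unshelve. all: by end_near. Qed.

(** * Realization on the interval *)

Theorem theorem1p3 (R : realType) (C : metricType R) (T : C -> C)
    (hCT : cantor_system T) (hT : minimal_system T) :
  exists (f : R -> R) (h : C -> R),
    [/\ set_fun `[0, 1] `[0, 1] f,
        differentiable_on `[0, 1] f,
        set_fun [set: C] `[0, 1] h /\ embedding h,
        f \o h = h \o T &
        forall x : R, range h x -> has_derivative_on `[0, 1] f x 0].
Proof.
have [c [e tc]] := tower_codes_exist hCT hT.
case: hCT => -[C0 CC] cT; have [_ cC _ _] := CC.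
have [M [w wc]] := code_weights_exist R cC tc.
have [h [h01 ch hI hflat]] := embedding_of_weights tc wc.
have [_ [g hK _]] := compact_injective_embedding C0 cC ch hI.
have crange : closed (range h).
  apply: compact_closed; first exact: Rhausdorff.
  by apply: continuous_compact => //; exact: continuous_subspaceT.
(* Two half-lines, at distance at least 1 from [h(C)] and mapped to 0, make the
   set unbounded without affecting derivatives on [h(C)]. *)
pose K := range h `|` ([set y | y <= -1] `|` [set y | 2 <= y]).
pose F y := if pselect (range h y) then h (T (g y)) else 0.
have Fh x : F (h x) = h (T x).
  by rewrite /F; case: pselect => [hx|[]]; [rewrite hK | exists x].
have F0 y : ~ range h y -> F y = 0.
  by move=> nhy; rewrite /F; case: pselect => [hy|//]; case: (nhy hy).
have far x y : K y -> ~ range h y -> 1 <= `|y - h x|.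
  move=> Ky nhy; have /andP[? ?] := h01 x; case: Ky => [//|[/= y1|/= y2]].
    by rewrite distrC (le_trans _ (ler_norm _)) //; lra.
  by rewrite (le_trans _ (ler_norm _)) //; lra.
have [|||||f [fF f01 df f0]] := @flat_extension R K F.
- apply: closedU => //.
  by apply: closedU; [exact: closed_le | exact: closed_ge].
- move=> y; exists (Num.min y (-1)); last by rewrite ge_min lexx.
  by right; left; rewrite /= ge_min lexx orbT.
- move=> y; exists (Num.max y 2); last by rewrite le_max lexx.
  by right; right; rewrite /= le_max lexx orbT.
- move=> x _; have [[z _ <-]|nhx] := pselect (range h x); first by rewrite Fh.
  by rewrite F0 // lexx ler01.
- move=> x Kx eps e0; have [[z _ <-]|nhx] := pselect (range h x).
    have [d d0 dP] := hflat z _ e0; exists (Num.min d 1).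
      by rewrite lt_min d0 ltr01.
    move=> y Ky; rewrite lt_min => /andP[yd y1].
    have [[u _ uy]|nhy] := pselect (range h y).
      by move: yd; rewrite -uy !Fh; exact: dP.
    by have := far z _ Ky nhy; rewrite leNgt y1.
  exists 1 => // y Ky y1; have [[u _ uy]|nhy] := pselect (range h y).
    by have := far u _ Kx nhx; rewrite uy distrC leNgt y1.
  by rewrite !F0 // subrr normr0 mulr_ge0 // ltW.
exists f, h; split.
- by move=> x _ /=; rewrite in_itv /=; exact: f01.
- move=> x _; have [l lP] := df x; exists l.
  exact: has_derivative_on_subset lP.
- split; first by move=> x _ /=; rewrite in_itv /=; exact: h01.
  exact: compact_injective_embedding.
- by apply/funext => x /=; rewrite fF ?Fh //; left; exists x.
- move=> x hx; apply: (@has_derivative_on_subset _ _ setT) => //.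
  by apply: f0; left.
Qed.
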